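(* Let $t\geq 3$, and let $H$ be a graph on $n$ vertices with $t$ distinct valencies. Then there exists a connected graph $G$ on at most $2^{n+2}$ vertices with exactly two main eigenvalues and at least $t$ distinct valencies, having $H$ as an induced subgraph.
   Context: All graphs are finite and simple. The valency of a vertex is its degree. An eigenvalue $\mu$ of the $(0,1)$-adjacency matrix $A$ of a graph is called a main eigenvalue if there exists an eigenvector of $A$ corresponding to $\mu$ that is not orthogonal to the all-ones vector $\mathbf{j}$. The number of main eigenvalues counts distinct eigenvalues. *)

(* Defs.v *)
From mathcomp Require Import all_boot all_order all_algebra.
From mathcomp Require Import reals.

Set Implicit Arguments.
Unset Strict Implicit.
Unset Printing Implicit Defensive.

Import Order.TTheory GRing.Theory Num.Theory.

Record sgraph := SGraph {
  vertex :> finType;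
  adj : rel vertex;
  adj_sym : symmetric adj;
  adj_irrefl : irreflexive adj }.

Definition valency (G : sgraph) (x : G) : nat := #|[set y : G | adj x y]|.

Definition num_valencies (G : sgraph) : nat :=
  size (undup (codom (@valency G))).

Definition connected_graph (G : sgraph) : Prop :=
  0 < #|G| /\ forall x y : G, connect (@adj G) x y.

(* Up to isomorphism: G[f(H)] is a copy of H. *)
Definition induced_subgraph (H G : sgraph) : Prop :=
  exists2 f : H -> G, injective f & forall x y : H, adj (f x) (f y) = adj x y.

Local Open Scope ring_scope.

(* Vertices are numbered by [enum_val]; the spectral notions below do not
   depend on the numbering. *)
Definition adjacency_mx (R : realType) (G : sgraph) : 'M[R]_#|G| :=
  \matrix_(i < #|G|, j < #|G|) (adj (enum_val i) (enum_val j))%:R.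

(* The library's eigenvectors are row vectors (v A = mu v); as the adjacency
   matrix is symmetric, these are the transposes of the usual ones. *)
Definition main_eigenvalue (R : realType) (G : sgraph) (mu : R) : Prop :=
  exists v : 'rV[R]_#|G|,
    [/\ v != 0,
        (v <= eigenspace (adjacency_mx R G) mu)%MS
      & v *m (const_mx 1 : 'rV[R]_#|G|)^T != 0].

Definition num_main_eigenvalues (R : realType) (G : sgraph) (k : nat) : Prop :=
  exists s : seq R,
    [/\ uniq s, size s = k & forall mu : R, mu \in s <-> main_eigenvalue G mu].

(* Main.v *)
(* Let N be the order of G and M = J - 2 A the matrix of signs (-1)^adj, with
   row sums rho = M j. If M^2 = N I, then the span of j and rho is invariant
   under A, so every main eigenvalue is a root of one explicit quadratic; if
   rho is not constant, both roots are real, distinct and main. To embed H in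
   such a G, extend H by isolated vertices to a graph e on F_2^k and take
   signs e(x,y) chi_{x+y}(p+q) on pairs (x,p), (y,q) of F_2^k x F_2^k: the
   blocks are rank-one matrices arranged along a Latin square, so M^2 = N I
   holds whatever the signs of the blocks. Switching at all vertices (x,0)
   then makes the valency of (x,0) an affine function of that of x in e. *)
Require Import Defs.
From mathcomp Require Import all_boot all_order all_algebra.
From mathcomp Require Import reals.
From mathcomp Require Import ring lra zify.

Set Implicit Arguments.
Unset Strict Implicit.
Unset Printing Implicit Defensive.

Import Order.TTheory GRing.Theory Num.Theory.

(** * Main eigenvalues of a graph whose sign matrix squares to [N I] *)

Section GraphSpectrum.
Variables (R : realType) (G : sgraph).
Local Open Scope ring_scope.

Lemma sum_enum_val (F : G -> R) :
  \sum_(i < #|G|) F (enum_val i) = \sum_x F x.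
Proof. by rewrite -big_enum_val. Qed.

(** Passing to functions on vertices removes the numbering. Symmetry of [adj] exchanges row and
    column eigenvectors, and [v != 0] follows from the nonzero sum. *)
Lemma main_eigenvalueP (mu : R) :
  main_eigenvalue G mu <->
  exists2 f : G -> R, \sum_x f x != 0 &
    forall x, \sum_y (adj x y)%:R * f y = mu * f x.
Proof.
split=> [[v [_ /eigenspaceP vA vj]] | [f fj fA]].
  exists (fun x => v 0 (enum_rank x)).
    move: vj; apply: contra_neq => s0; apply/matrixP=> i j.
    rewrite !mxE -[RHS]s0 -sum_enum_val; apply: eq_bigr => l _.
    by rewrite !mxE mulr1 enum_valK ord1.
  move=> x; move/matrixP: vA => /(_ 0 (enum_rank x)); rewrite !mxE => <-.
  rewrite -sum_enum_val; apply: eq_bigr => l _.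
  by rewrite !mxE enum_valK enum_rankK mulrC adj_sym.
pose v : 'rV[R]_#|G| := \row_i f (enum_val i).
have vj : v *m (const_mx 1 : 'rV[R]_#|G|)^T != 0.
  move: fj; apply: contra_neq => /matrixP/(_ 0 0); rewrite !mxE => s0.
  rewrite -[RHS]s0 -sum_enum_val; apply: eq_bigr => l _.
  by rewrite !mxE mulr1.
exists v; split=> //.
  by apply: contra_neq vj => ->; rewrite mul0mx.
apply/eigenspaceP/matrixP=> i j; rewrite !mxE -fA -sum_enum_val.
by apply: eq_bigr => l _; rewrite !mxE mulrC adj_sym.
Qed.

Lemma valencyE (x : G) : (valency x)%:R = \sum_y (adj x y)%:R :> R.
Proof.
rewrite -natr_sum; congr _%:R; rewrite /valency cardsE -sum1_card.
by rewrite big_mkcond.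
Qed.

Lemma sum_sign (x : G) :
  \sum_y (-1) ^+ adj x y = #|G|%:R - 2 * (valency x)%:R :> R.
Proof.
rewrite valencyE mulr_sumr -sum1_card natr_sum -sumrB.
by apply: eq_bigr => y _; case: adj => /=; rewrite ?expr0 ?expr1; ring.
Qed.

(** Entrywise [M^2 = N I]: the sign matrix [M] is a symmetric Hadamard matrix with unit diagonal. *)
Definition sign_orthogonal :=
  forall x z : G, \sum_y (-1) ^+ adj x y * (-1) ^+ adj y z
                  = #|G|%:R * (x == z)%:R :> R.

Hypothesis orthG : sign_orthogonal.

Let N : R := #|G|%:R.
Let rho (x : G) : R := \sum_y (-1) ^+ adj x y.
Let sigma : R := \sum_x rho x.

Lemma adjE (x y : G) : (adj x y)%:R = (1 - (-1) ^+ adj x y) / 2 :> R.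
Proof. by case: adj => /=; rewrite ?expr0 ?expr1; field. Qed.

(** [M rho = M^2 j]. *)
Lemma sum_sign_rho (x : G) : \sum_y (-1) ^+ adj x y * rho y = N.
Proof.
under eq_bigr do rewrite mulr_sumr.
rewrite exchange_big /=; under eq_bigr do rewrite orthG.
rewrite -mulr_sumr (bigD1 x) //= eqxx big1 ?addr0 ?mulr1 // => z.
by rewrite eq_sym => /negPf->.
Qed.

(** Use [A = (J - M) / 2] and [J rho = sigma j]. *)
Lemma sum_adj_rho (x : G) : \sum_y (adj x y)%:R * rho y = (sigma - N) / 2.
Proof.
rewrite -(sum_sign_rho x) /sigma -sumrB mulr_suml.
by apply: eq_bigr => y _; rewrite adjE; field.
Qed.

Lemma sum_adj1 (x : G) : \sum_y (adj x y)%:R = (N - rho x) / 2 :> R.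
Proof. by rewrite -valencyE /rho sum_sign /N; field. Qed.

(** As [M] is symmetric, the squared norm of [rho = M j] is [j^T M^2 j]. *)
Lemma sum_rho_sqr : \sum_x rho x ^+ 2 = N ^+ 2.
Proof.
have -> : N ^+ 2 = \sum_(x : G) \sum_y (-1) ^+ adj x y * rho y.
  under eq_bigr do rewrite sum_sign_rho.
  by rewrite sumr_const expr2 mulr_natr.
rewrite exchange_big /=; apply: eq_bigr => x _.
rewrite -mulr_suml expr2; congr (_ * _).
by apply: eq_bigr => y _; rewrite adj_sym.
Qed.

(** Pair the eigenvector [f] with [rho] and with [j], moving the symmetric [A] across. Eliminating
    the pairing with [rho] leaves the quadratic times the nonzero sum of [f]. *)
Lemma main_eigenvalue_quadratic (mu : R) :
  main_eigenvalue G mu -> 2 * mu ^+ 2 - N * mu + (sigma - N) / 2 = 0.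
Proof.
case/main_eigenvalueP=> f fj fA.
have sum_swap (g : G -> R) :
    mu * \sum_x f x * g x = \sum_x f x * \sum_y (adj x y)%:R * g y.
  rewrite mulr_sumr; under eq_bigr do rewrite mulrA -fA mulr_suml.
  rewrite exchange_big /=; apply: eq_bigr => x _.
  rewrite mulr_sumr; apply: eq_bigr => y _.
  by rewrite adj_sym mulrAC mulrA mulrC; ring.
have e1 : mu * \sum_x f x * rho x = (\sum_x f x) * ((sigma - N) / 2).
  rewrite sum_swap mulr_suml; apply: eq_bigr => x _.
  by rewrite sum_adj_rho.
have e2 : mu * \sum_x f x = (N * \sum_x f x - \sum_x f x * rho x) / 2.
  have := sum_swap (fun=> 1); under eq_bigr do rewrite mulr1.
  move=> ->; rewrite mulr_sumr -sumrB mulr_suml; apply: eq_bigr => x _.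
  by under eq_bigr do rewrite mulr1; rewrite sum_adj1; field.
apply: (mulfI fj); rewrite mulr0.
have e3 : \sum_x f x * rho x = N * \sum_x f x - 2 * (mu * \sum_x f x).
  by rewrite e2; field.
by rewrite e3 in e1; rewrite mulrDr -e1; ring.
Qed.

Hypothesis irregG : exists x y : G, valency x != valency y.

(* Strict Cauchy-Schwarz for the row sums [rho] and the all-ones vector. *)
Lemma sigma_sqr_lt : sigma ^+ 2 < N ^+ 3.
Proof.
have [x [y xy]] := irregG.
have N0 : 0 < N by rewrite ltr0n; apply/card_gt0P; exists x.
have rxy : rho x != rho y.
  apply: contra xy => /eqP; rewrite /rho !sum_sign => e.
  by rewrite -(eqr_nat R); apply/eqP; lra.
have var_gt0 : 0 < \sum_z (N * rho z - sigma) ^+ 2.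
  have [z nz] : exists z, N * rho z - sigma != 0.
    have [/eqP e|nx] := boolP (N * rho x - sigma == 0); last by exists x.
    exists y; apply: contra rxy => /eqP e'; apply/eqP/(mulfI (lt0r_neq0 N0)).
    by lra.
  rewrite (bigD1 z) //= ltr_pwDl ?exprn_even_gt0 //.
  by apply: sumr_ge0 => w _; rewrite sqr_ge0.
have varE : \sum_z (N * rho z - sigma) ^+ 2 = N * (N ^+ 3 - sigma ^+ 2).
  transitivity (\sum_z (N ^+ 2 * rho z ^+ 2 - 2 * N * sigma * rho z
                        + sigma ^+ 2)).
    by apply: eq_bigr => z _; ring.
  rewrite big_split sumrB /= -!mulr_sumr sum_rho_sqr -/sigma sumr_const.
  by rewrite -[_ *+ _]mulr_natr -/N; ring.
by move: var_gt0; rewrite varE pmulr_rgt0 // subr_gt0.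
Qed.

(** On the span of [j] and [rho], the vector [rho - 2 mu j] is an eigenvector exactly when the
    quadratic vanishes at [mu]. *)
Lemma quadratic_main_eigenvalue (mu : R) :
  2 * mu ^+ 2 - N * mu + (sigma - N) / 2 = 0 -> main_eigenvalue G mu.
Proof.
move=> q; apply/main_eigenvalueP; exists (fun x => rho x - 2 * mu).
  rewrite sumrB sumr_const -[_ *+ _]mulr_natr -/N -/sigma subr_eq0.
  (* A zero sum means [sigma = 2 mu N]; the quadratic then forces equality in Cauchy-Schwarz. *)
  apply/eqP=> sE; have := sigma_sqr_lt; suff -> : sigma ^+ 2 = N ^+ 3.
    by rewrite ltxx.
  suff -> : N ^+ 3 = sigma ^+ 2 - 2 * N ^+ 2
      * (2 * mu ^+ 2 - N * mu + (sigma - N) / 2) by rewrite q mulr0 subr0.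
  by rewrite sE; field.
move=> x; under eq_bigr do rewrite mulrBr.
rewrite sumrB -mulr_suml sum_adj_rho sum_adj1.
by apply/eqP; rewrite -subr_eq0 -[X in _ == X]q; apply/eqP; field.
Qed.

Lemma sign_orthogonal_two_main_eigenvalues : num_main_eigenvalues R G 2.
Proof.
pose D := N ^+ 2 - 4 * (sigma - N).
have D0 : 0 < D.
  have N0 : 0 <= N by rewrite ler0n.
  rewrite -[D]/(N ^+ 2 - 4 * (sigma - N)).
  (* Otherwise [(N^2 + 4N)^2 <= 16 sigma^2 < 16 N^3], although
     [(N^2 + 4N)^2 - 16 N^3 = (N (N - 4))^2]. *)
  rewrite ltNge; apply/negP => D0.
  have h1 : 0 <= N ^+ 2 + 4 * N by nra.
  have h2 : N ^+ 2 + 4 * N <= 4 * sigma by lra.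
  have h3 : (N ^+ 2 + 4 * N) ^+ 2 <= (4 * sigma) ^+ 2.
    by rewrite ler_pXn2r ?nnegrE //; lra.
  have := sigma_sqr_lt.
  have : 0 <= (N * (N - 4)) ^+ 2 by rewrite sqr_ge0.
  by move=> h4 h5; lra.
have s2 : Num.sqrt D ^+ 2 = D by rewrite sqr_sqrtr // ltW.
have s0 : 0 < Num.sqrt D by rewrite sqrtr_gt0.
move: (Num.sqrt D) s2 s0 => s s2 s0.
have factor mu : 2 * mu ^+ 2 - N * mu + (sigma - N) / 2
    = 2 * ((mu - (N + s) / 4) * (mu - (N - s) / 4)).
  have -> : sigma = (N ^+ 2 - s ^+ 2) / 4 + N by rewrite s2 /D; field.
  by field.
exists [:: (N + s) / 4; (N - s) / 4]; split=> //=.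
  by rewrite inE andbT; apply/eqP=> e; lra.
move=> mu; rewrite !inE; split=> [h | /main_eigenvalue_quadratic].
  apply: quadratic_main_eigenvalue; rewrite factor.
  by case/orP: h => /eqP->; rewrite subrr ?mul0r !mulr0.
rewrite factor => /eqP; rewrite mulf_eq0 pnatr_eq0 /= mulf_eq0 !subr_eq0.
by [].
Qed.

End GraphSpectrum.

(** * Counting valencies, and connectedness *)

Lemma num_valencies_le (G : sgraph) (s : seq nat) :
  (forall x : G, valency x \in s) -> num_valencies G <= size s.
Proof.
move=> sP; apply: uniq_leq_size (undup_uniq _) _ => d.
by rewrite mem_undup => /codomP[x ->].
Qed.

Lemma num_valencies_irregular (G : sgraph) :
  1 < num_valencies G -> exists x y : G, valency x != valency y.
Proof.
move=> G1; have [x _|G0] := pickP (@predT G); last first.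
  suff : num_valencies G <= size ([::] : seq nat) by rewrite leqNgt (ltnW G1).
  by apply: (@num_valencies_le G [::]) => x; have := G0 x.
have [reg|] := boolP [forall y : G, valency x == valency y].
  suff : num_valencies G <= size [:: valency x] by rewrite leqNgt G1.
  by apply: (@num_valencies_le G [:: valency x]) => y; rewrite inE eq_sym (forallP reg).
by rewrite negb_forall => /existsP[y xy]; exists x, y.
Qed.

Lemma num_valencies_affine (H G : sgraph) (f : H -> G) (a b : nat) :
  0 < a -> (forall x, valency (f x) = a * valency x + b) ->
  num_valencies H <= num_valencies G.
Proof.
move=> a0 fP.
rewrite /num_valencies -(size_map (fun d => a * d + b)).
apply: uniq_leq_size => [|d /mapP[d0 + ->]].
  rewrite map_inj_uniq ?undup_uniq // => d d' /addIn/eqP.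
  by rewrite eqn_pmul2l // => /eqP.
by rewrite mem_undup => /codomP[x ->]; rewrite mem_undup -fP codom_f.
Qed.

(* Vertices in different components have no common neighbour, so orthogonality
   of their sign rows forces their valencies to sum to |G|/2. *)
Lemma sign_orthogonal_connected (R : realType) (G : sgraph) :
  sign_orthogonal R G -> 2 < num_valencies G -> connected_graph G.
Proof.
move=> orthG G2; split.
  by have [x _] := num_valencies_irregular (ltnW G2); apply/card_gt0P; exists x.
have csym := sym_connect_sym (@adj_sym G).
have valD x z : ~~ connect (@adj G) x z -> 2 * (valency x + valency z) = #|G|.
  move=> xz; apply/eqP; rewrite -(eqr_nat R) natrM natrD.
  have xneqz : x == z = false by apply: contraNF xz => /eqP->; exact: connect0.
  have := orthG x z; rewrite xneqz mulr0.
  under eq_bigr => y _.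
    rewrite (_ : _ * _ = 1 - 2 * (adj x y)%:R - 2 * (adj z y)%:R)%R; last first.
      case: (boolP (adj x y)); case: (boolP (adj z y)); rewrite [adj y z]adj_sym.
      - move=> zy xy; case/negP: xz; apply: connect_trans (connect1 xy) _.
        by rewrite csym connect1.
      - by move=> /negPf-> _; rewrite /= expr0 expr1; ring.
      - by move=> -> _; rewrite /= expr0 expr1; ring.
      - by move=> /negPf-> _; rewrite /= expr0; ring.
    over.
  rewrite !sumrB sumr_const -!mulr_sumr -!valencyE => e.
  by apply/eqP; lra.
(* Every [u] is disconnected from [x] or from [z], hence has the valency of [z] or of [x]
   respectively: only two values occur. *)
move=> x z; apply: contraLR G2 => xz; rewrite -leqNgt.
apply: (@num_valencies_le _ [:: valency x; valency z]) => u; rewrite !inE.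
have := valD _ _ xz; have [xu|/valD] := boolP (connect (@adj G) x u).
  have /valD : ~~ connect (@adj G) u z.
    by apply: contra xz; apply: connect_trans.
  by lia.
by lia.
Qed.

(** * The sign-orthogonal graph on F_2^k x F_2^k *)

Section AffineHadamard.
Variables (R : realType) (k : nat).
Local Notation V := 'rV[bool]_k.
Variables (e : rel V) (e_sym : symmetric e) (e_irr : irreflexive e).
Local Open Scope ring_scope.

(** The standard bilinear form, with [bool] as F_2; [(-1) ^+ dot a b] is the character chi_a at
    [b]. *)
Definition dot (a b : V) : bool := \big[addb/false]_i (a 0 i && b 0 i).

Lemma dotC a b : dot a b = dot b a.
Proof. by apply: eq_bigr => i _; rewrite andbC. Qed.

Lemma dotDl a a' b : dot (a + a') b = dot a b (+) dot a' b.
Proof. by rewrite -big_split /=; apply: eq_bigr => i _; rewrite mxE -andb_addl. Qed.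

Lemma dotDr a b b' : dot a (b + b') = dot a b (+) dot a b'.
Proof. by rewrite dotC dotDl !(dotC a). Qed.

Lemma dot0l b : dot 0 b = false.
Proof. by rewrite /dot big1 // => i _; rewrite mxE. Qed.

Lemma rowbool_addxx (a : V) : a + a = 0.
Proof. by apply/matrixP=> i j; rewrite !mxE; exact: addbb. Qed.

Lemma rowbool_add_eq0 (a b : V) : (a + b == 0) = (a == b).
Proof. by rewrite -(inj_eq (addIr b)) add0r -addrA rowbool_addxx addr0. Qed.

(** If [a 0 i] is true, translating [b] by the unit vector at [i] flips every sign, so the sum
    equals its opposite. *)
Lemma sum_sign_dot a : \sum_b (-1) ^+ dot a b = (2 ^ k)%:R * (a == 0)%:R :> R.
Proof.
have [->|/rV0Pn[i ai]] := eqVneq a 0.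
  under eq_bigr do rewrite dot0l expr0.
  by rewrite sumr_const card_mx card_bool mul1n mulr1.
rewrite mulr0; set S := \sum_b _.
suff : S = - S by move=> ?; lra.
rewrite {1}/S (reindex_inj (addrI (delta_mx 0 i))) /= -sumrN.
apply: eq_bigr => b _; rewrite dotDr signr_addb dotC.
suff -> : dot (delta_mx 0 i) a by rewrite expr1 mulN1r.
rewrite /dot (bigD1 i) //= big1 ?addbF; first by rewrite mxE !eqxx; case: (a 0 i) ai.
by move=> j ji; rewrite mxE (negPf ji).
Qed.

(* The last two summands are the switching at the vertices with second
   coordinate 0. *)
Definition hadamard_adj : rel (V * V) := fun u w =>
  e u.1 w.1 (+) dot (u.1 + w.1) (u.2 + w.2) (+) (u.2 == 0) (+) (w.2 == 0).

Lemma hadamard_adj_sym : symmetric hadamard_adj.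
Proof.
move=> u w; rewrite /hadamard_adj e_sym [w.1 + _]addrC [w.2 + _]addrC.
by rewrite addbAC.
Qed.

Lemma hadamard_adj_irrefl : irreflexive hadamard_adj.
Proof.
by move=> u; rewrite /hadamard_adj e_irr rowbool_addxx dot0l !addFb addbb.
Qed.

Definition hadamard_graph : sgraph :=
  SGraph hadamard_adj_sym hadamard_adj_irrefl.

Lemma card_hadamard_graph : #|hadamard_graph| = (2 ^ k * 2 ^ k)%N.
Proof. by rewrite card_prod card_mx card_bool mul1n. Qed.

(** Summing over [q] first, the switching signs at [q] cancel and a character sum forces [x = z].
    Then the signs of [e] square to 1, and a character sum over [y] forces [p = r]. *)
Lemma hadamard_graph_orthogonal : sign_orthogonal R hadamard_graph.
Proof.
move=> [x p] [z r]; rewrite card_hadamard_graph natrM.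
pose chi (b : bool) : R := (-1) ^+ b.
have chiD b b' : chi (b (+) b') = chi b * chi b' by rewrite /chi signr_addb.
have chi_sqr b : chi b * chi b = 1 by rewrite -chiD addbb.
rewrite [LHS](_ : _ = chi (p == 0) * chi (r == 0) *
    \sum_y chi (e x y) * chi (e y z) * chi (dot (x + y) p) * chi (dot (y + z) r)
           * \sum_q chi (dot (x + z) q)); last first.
  rewrite mulr_sumr.
  under [RHS]eq_bigr do rewrite mulrA mulr_sumr.
  rewrite pair_big /=; apply: eq_bigr => -[y q] _ /=.
  rewrite /hadamard_adj /= -[X in X * _]/(chi _) -[X in _ * X]/(chi _).
  have -> : dot (x + z) q = dot (x + y) q (+) dot (y + z) q.
    by rewrite -dotDl addrA -(addrA x) rowbool_addxx addr0.
  by rewrite !dotDr !chiD -[RHS]mulr1 -(chi_sqr (q == 0)); ring.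
under eq_bigr do rewrite sum_sign_dot.
rewrite -mulr_suml rowbool_add_eq0 xpair_eqE.
have [<-{z}|_] := eqVneq x z; last by rewrite !mulr0.
under eq_bigr => y _.
  rewrite [e y x]e_sym chi_sqr mul1r -chiD [y + x]addrC -dotDr dotC.
  over.
have -> : \sum_y chi (dot (p + r) (x + y)) = \sum_y chi (dot (p + r) y).
  by rewrite [RHS](reindex_inj (addrI x)).
rewrite sum_sign_dot rowbool_add_eq0 mulr1.
have [<-|_] := eqVneq p r; last by rewrite !(mulr0, mul0r).
by rewrite chi_sqr; ring.
Qed.

Lemma hadamard_graph_valency0 (x : V) :
  (2 * valency ((x, 0%R : V) : hadamard_graph) + 2 ^ k
   = 4 * #|[set y | e x y]| + 2 ^ k * 2 ^ k)%N.
Proof.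
apply/eqP; rewrite -(eqr_nat R) !natrD !natrM; apply/eqP.
have := sum_sign R ((x, 0%R : V) : hadamard_graph).
rewrite card_hadamard_graph natrM => eqG.
have card_e : #|[set y | e x y]|%:R = \sum_y (e x y)%:R :> R.
  by rewrite -natr_sum -sum1dep_card big_mkcond.
suff rowE : \sum_w (-1) ^+ @adj hadamard_graph (x, 0 : V) w
    = (2 ^ k)%:R - 4 * \sum_y (e x y)%:R :> R.
  by rewrite card_e; rewrite rowE in eqG; lra.
(* Switching at [(x, 0)] negates the row; switching at [(y, 0)] restores the entry [q = 0], whence
   the correction by 2 in block [y]. *)
transitivity (\sum_y - (-1) ^+ e x y * ((2 ^ k)%:R * (x == y)%:R - 2) : R).
  transitivity (\sum_y - (-1) ^+ e x y
       * (\sum_q (-1) ^+ dot (x + y) q - \sum_(q : V) (q == 0)%:R * 2) : R).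
    under [RHS]eq_bigr do rewrite -sumrB mulr_sumr.
    rewrite pair_big /=; apply: eq_bigr => -[y q] _ /=.
    rewrite /hadamard_adj /= eqxx add0r addbT addNb signrN !signr_addb.
    have [->|_] := eqVneq q 0; last by rewrite /=; ring.
    by rewrite dotC dot0l /= expr0 expr1; ring.
  apply: eq_bigr => y _; rewrite sum_sign_dot rowbool_add_eq0 (bigD1 0) //=.
  by rewrite eqxx big1 ?addr0 ?mul1r // => q /negPf->; rewrite mul0r.
rewrite (bigD1 x) //= eqxx e_irr.
rewrite (eq_bigr (fun y => 2 - 4 * (e x y)%:R)) => [|y]; last first.
  by rewrite eq_sym => /negPf->; case: e; rewrite /= ?expr0 ?expr1; ring.
rewrite sumrB -mulr_sumr [\sum_y (e x y)%:R in RHS](bigD1 x) //= e_irr add0r.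
suff -> : \sum_(i | i != x) 2 = 2 * ((2 ^ k)%:R - 1) :> R.
  by rewrite expr0; ring.
rewrite sumr_const cardC1 card_mx card_bool mul1n -[_ *+ _.-1]mulr_natr.
by rewrite -subn1 natrB ?expn_gt0.
Qed.

End AffineHadamard.

Theorem theorem3p4 (R : realType) (t n : nat) (H : sgraph)
  (ht : 3 <= t) (hn : #|H| = n) (hval : num_valencies H = t) :
  exists G : sgraph,
    [/\ connected_graph G,
        #|G| <= 2 ^ (n + 2),
        num_main_eigenvalues R G 2,
        t <= num_valencies G
      & induced_subgraph H G].
Proof.
have n3 : 3 <= n.
  rewrite -hn (leq_trans ht) // -hval (leq_trans (size_undup _)) //.
  by rewrite size_codom.
pose k := up_log 2 n.
have /andP[k_lt k_ge] : 2 ^ k.-1 < n <= 2 ^ k by apply: up_log_bounds; lia.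
(* [G] will have [2 ^ (k + k)] vertices; the bound follows from [2 (k - 1) <= 2 ^ (k - 1) < n]. *)
have k_small : k + k <= n + 2.
  have exp_ge j : 0 < j -> 2 * j <= 2 ^ j.
    by elim: j => // -[|j] IH _ //; rewrite expnS; have := IH isT; lia.
  have := exp_ge k.-1; lia.
have card_V : #|H| <= #|{: 'rV[bool]_k}| by rewrite card_mx card_bool mul1n hn.
pose phi (i : H) : 'rV[bool]_k := enum_val (widen_ord card_V (enum_rank i)).
have phi_inj : injective phi.
  by move=> i j /enum_val_inj/(congr1 val)/= /val_inj/enum_rank_inj.
(* The copy of [H] under [phi], with all vectors outside the image isolated. *)
pose e (x y : 'rV[bool]_k) :=
  [exists i, exists j, [&& phi i == x, phi j == y & adj i j]].
have e_phi i j : e (phi i) (phi j) = adj i j.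
  apply/existsP/idP=> [[i' /existsP[j' /and3P[]]]|ij].
    by move=> /eqP/phi_inj-> /eqP/phi_inj->.
  by exists i; apply/existsP; exists j; rewrite !eqxx.
have e_sym : symmetric e.
  suff e_swap x y : e x y -> e y x by move=> x y; apply/idP/idP; apply: e_swap.
  move=> /existsP[i /existsP[j /and3P[ix jy ij]]].
  by apply/existsP; exists j; apply/existsP; exists i; rewrite ix jy adj_sym.
have e_irr : irreflexive e.
  move=> x; apply/existsP=> -[i /existsP[j /and3P[/eqP<- /eqP/phi_inj->]]].
  by rewrite adj_irrefl.
pose G := hadamard_graph e_sym e_irr.
pose f (i : H) : G := (phi i, 0%R).
have e_val i : #|[set y | e (phi i) y]| = valency i.
  rewrite /valency -(card_imset _ phi_inj); congr #|pred_of_set _|.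
  apply/setP=> y; rewrite inE; apply/idP/imsetP=> [|[j + ->]]; last first.
    by rewrite inE e_phi.
  move=> /existsP[i' /existsP[j /and3P[/eqP/phi_inj-> /eqP<- ij]]].
  by exists j; rewrite ?inE.
have G_val : t <= num_valencies G.
  rewrite -hval.
  (* The halving is exact: [hadamard_graph_valency0] shows that the difference is even. *)
  apply: (@num_valencies_affine _ _ f 2 ((2 ^ k * 2 ^ k - 2 ^ k) %/ 2)) => // i.
  have := hadamard_graph_valency0 R e_sym e_irr (phi i).
  rewrite e_val -/G -/(f i).
  have : 2 ^ k * 2 ^ k >= 2 ^ k by rewrite leq_pmulr ?expn_gt0.
  by lia.
have G_orth := @hadamard_graph_orthogonal R k e e_sym e_irr.
exists G; split=> //.
- by apply: sign_orthogonal_connected G_orth _; apply: leq_trans G_val.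
- by rewrite card_hadamard_graph -expnD leq_exp2l.
- apply: sign_orthogonal_two_main_eigenvalues G_orth _.
  by apply: num_valencies_irregular; apply: leq_trans G_val; apply: ltnW.
exists f => [i j [] /phi_inj //|i j].
(* Between vertices with second coordinate 0 the form vanishes and the two switchings cancel,
   leaving [e]. *)
rewrite /= /hadamard_adj /= e_phi addr0 eqxx dotC dot0l.
by rewrite !addbT addbF negbK.
Qed.
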